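(* Let $G^{(1)},\ldots,G^{(N)}$ be a sample of undirected unweighted simple labeled graphs with vertex set $\{1,\ldots,n\}$, with adjacency matrices $\bm{A}^{(1)},\ldots,\bm{A}^{(N)}$. Let $\widehat{\bm{\mu}}_N[\bm{A}]$ be the adjacency matrix of a sample Fréchet mean graph, and let $\widehat{\bm{m}}_N[\bm{A}]$ be the adjacency matrix of a sample Fréchet median graph. Let $e_{\widehat{\bm{\mu}}}$ and $e_{\widehat{\bm{m}}}$ be the number of edges of $\widehat{\bm{\mu}}_N[\bm{A}]$ and $\widehat{\bm{m}}_N[\bm{A}]$ respectively. Let $\overline{e}_N$ be the sample mean and $\sigma_N^2(e)$ (with $\sigma_N(e)\ge 0$) the sample variance of the number of edges. (i) If the Fréchet mean and median graphs are computed using the Hamming distance $d=d_H$, then $$e_{\widehat{\bm{\mu}}} < 2\,\overline{e}_N + \frac{\sigma_N(e)}{\sqrt 2} \quad\text{and}\quad e_{\widehat{\bm{m}}} < 2\,\overline{e}_N .$$ (ii) If the Fréchet mean and median graphs are computed using the adjacency spectral pseudometric $d=d_\lambda$, then $$e_{\widehat{\bm{\mu}}} < 9\,\overline{e}_N \quad\text{and}\quad e_{\widehat{\bm{m}}} < 9\,\overline{e}_N .$$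
   Context: Let $\mathcal{G}$ be the set of all undirected unweighted simple labeled graphs with vertex set $\{1,\ldots,n\}$, and let $\mathcal{S}$ be the set of their adjacency matrices, i.e. symmetric matrices in $\{0,1\}^{n\times n}$ with zero diagonal. Graphs are identified with their adjacency matrices. For $\bm{A}=(a_{ij})\in\mathcal{S}$, the number of edges is $e(\bm{A})=\sum_{1\le i<j\le n}a_{ij}$, and $\bm{\lambda}(\bm{A})=(\lambda_1(\bm{A}),\ldots,\lambda_n(\bm{A}))$ is the vector of eigenvalues of $\bm{A}$ (with multiplicity) ordered so that $\lambda_1(\bm{A})\ge\cdots\ge\lambda_n(\bm{A})$. The Hamming distance is $d_H(\bm{A},\bm{A}')=\sum_{1\le i<j\le n}|a_{ij}-a'_{ij}|$. The adjacency spectral pseudometric is $d_\lambda(\bm{A},\bm{A}')=\|\bm{\lambda}(\bm{A})-\bm{\lambda}(\bm{A}')\|_2$ (Euclidean norm). Given a metric or pseudometric $d$ on $\mathcal{G}$ and a sample $G^{(1)},\ldots,G^{(N)}\in\mathcal{G}$, a sample Fréchet mean graph is any minimizer over $G\in\mathcal{G}$ of $\frac1N\sum_{k=1}^N d^2(G,G^{(k)})$, and a sample Fréchet median graph is any minimizer over $G\in\mathcal{G}$ of $\frac1N\sum_{k=1}^N d(G,G^{(k)})$. Minimizers always exist but need not be unique; the results are stated for any of the minimizers. The sample mean and variance of the number of edges are $\overline{e}_N=\frac1N\sum_{k=1}^N e(\bm{A}^{(k)})$ and $\sigma_N^2(e)=\frac1N\sum_{k=1}^N [e(\bm{A}^{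(k)})]^2-[\overline{e}_N]^2$.
   Formalization: All bounds are proved with ≤ (for empty samples < fails); < is proved for the Hamming mean if σ>0, or the empty graph is not a mean, or some sample graph is not inside the mean; for the Hamming median if some edge has frequency not 0 or 1/2; for the spectral bounds if the mean edge count is >0. *)

(* Defs.v *)
From mathcomp Require Import all_boot all_order all_algebra.
From mathcomp Require Import sesquilinear spectral polyrcf complex.

Set Implicit Arguments.
Unset Strict Implicit.
Unset Printing Implicit Defensive.

Import Order.TTheory GRing.Theory Num.Theory.
Local Open Scope ring_scope.

(* A graph on n labelled vertices is identified with its adjacency matrix; the
   vertex set {1, ..., n} is 'I_n = {0, ..., n-1}.  Scalars range over an
   arbitrary real closed field R, the real numbers being one instance. *)
Definition adjacency (R : rcfType) (n : nat) (A : 'M[R]_n) : Prop :=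
  [/\ forall i j, A i j = 0 \/ A i j = 1,
      forall i j, A i j = A j i
    & forall i, A i i = 0].

Definition edges (R : rcfType) (n : nat) (A : 'M[R]_n) : R :=
  \sum_(i < n) \sum_(j < n | (i < j)%N) A i j.

Definition hamming (R : rcfType) (n : nat) (A B : 'M[R]_n) : R :=
  \sum_(i < n) \sum_(j < n | (i < j)%N) `|A i j - B i j|.

(* The list of real eigenvalues, each repeated according to its algebraic
   multiplicity, in non-increasing order (rootsR lists the distinct real roots).
   It has length n when A is symmetric: see spectrumP. *)
Definition spectrum (R : rcfType) (n : nat) (A : 'M[R]_n) : seq R :=
  let p := char_poly A in
  sort >=%R (flatten [seq nseq (mup x p) x | x <- rootsR p]).

Lemma char_poly_uconj (F : fieldType) (n : nat) (P D : 'M[F]_n) :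
  P \in unitmx -> char_poly (invmx P *m D *m P) = char_poly D.
Proof.
move=> Pu; rewrite /char_poly /char_poly_mx.
have Pu' : map_mx polyC P \in unitmx by rewrite map_unitmx.
have -> : 'X%:M - map_mx polyC (invmx P *m D *m P)
  = invmx (map_mx polyC P) *m ('X%:M - map_mx polyC D) *m map_mx polyC P.
  rewrite mulmxBr mulmxBl scalar_mxC -[_ *m map_mx polyC P]mulmxA.
  rewrite mulVmx // mulmx1.
  by rewrite !map_mxM map_invmx.
by rewrite !det_mulmx mulrC mulrA -det_mulmx mulmxV // det1 mul1r.
Qed.

Lemma symmetric_char_poly_split (R : rcfType) (n : nat) (A : 'M[R]_n) :
  A^T = A -> exists s : seq R, char_poly A = \prod_(x <- s) ('X - x%:P).
Proof.
move=> As; pose B := map_mx (real_complex R) A.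
have BR : B \is a realmx.
  by apply/mxOverP => i j; rewrite mxE complex_real.
have BS : B \is symmetricmx.
  by apply/is_hermitianmxP; rewrite expr0 scale1r map_mx_id // map_trmx As.
have BH := realsym_hermsym BS BR.
have dR := hermitian_spectral_diag_real BH.
have /orthomx_spectralP BE := hermitian_normalmx BH.
exists [seq complex.Re (spectral_diag B 0 i) | i <- enum 'I_n].
apply: (@map_poly_inj _ _ (real_complex R)).
rewrite map_char_poly -/B {1}BE char_poly_uconj ?spectral_unit //.
rewrite char_poly_trig ?diag_mx_is_trig // rmorph_prod big_map big_enum /=.
apply: eq_bigr => i _; rewrite rmorphB /= map_polyX map_polyC /= !mxE eqxx mulr1n.
by congr (_ - _%:P); rewrite RRe_real //; move/mxOverP: dR.
Qed.

Lemma spectrumP (R : rcfType) (n : nat) (A : 'M[R]_n) : A^T = A ->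
  [/\ size (spectrum A) = n, sorted >=%R (spectrum A)
    & char_poly A = \prod_(x <- spectrum A) ('X - x%:P)].
Proof.
move=> /symmetric_char_poly_split[s sE].
have p0 : char_poly A != 0 by rewrite monic_neq0 ?char_poly_monic.
suff pE : perm_eq (spectrum A) s.
  split; last by rewrite (perm_big _ pE).
    apply/eqP; rewrite (perm_size pE) -eqSS -(size_prod_XsubC _ idfun) -sE.
    by rewrite size_char_poly.
  exact: (sort_sorted (fun x y => le_total y x)).
rewrite /spectrum perm_sort; apply/allP => x _ /=; apply/eqP.
have -> : count_mem x s = mup x (char_poly A) by rewrite sE mu_prod_XsubC.
rewrite count_flatten -map_comp sumnE big_map.
have xr : (x \in rootsR (char_poly A)) = root (char_poly A) x.
  by have := roots_on_rootsR p0 x; rewrite in_itv.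
under eq_bigr do rewrite /= count_nseq /=.
have [rx|nrx] := boolP (root (char_poly A) x); last first.
  rewrite (mupNroot nrx) big1_seq // => y /andP[_ yr].
  by case: eqP yr => [->|//]; rewrite xr (negPf nrx).
rewrite (bigD1_seq x) ?uniq_roots ?xr //= eqxx mul1n big1 ?addn0 //.
by move=> y /negPf->.
Qed.

Definition eigenvalues (R : rcfType) (n : nat) (A : 'M[R]_n) : 'rV[R]_n :=
  \row_(i < n) (spectrum A)`_i.

Definition norm2 (R : rcfType) (n : nat) (v : 'rV[R]_n) : R :=
  Num.sqrt (\sum_(i < n) v 0 i ^+ 2).

Definition spectral_dist (R : rcfType) (n : nat) (A B : 'M[R]_n) : R :=
  norm2 (eigenvalues A - eigenvalues B).

Definition sample_mean (R : rcfType) (N : nat) (x : 'I_N -> R) : R :=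
  N%:R^-1 * \sum_(k < N) x k.

Definition sample_variance (R : rcfType) (N : nat) (x : 'I_N -> R) : R :=
  sample_mean (fun k => x k ^+ 2) - sample_mean x ^+ 2.

Definition sample_stddev (R : rcfType) (N : nat) (x : 'I_N -> R) : R :=
  Num.sqrt (sample_variance x).

Definition frechet_mean (R : rcfType) (n N : nat) (d : 'M[R]_n -> 'M[R]_n -> R)
    (A : 'I_N -> 'M[R]_n) (M : 'M[R]_n) : Prop :=
  adjacency M /\
  forall B : 'M[R]_n, adjacency B ->
    sample_mean (fun k => d M (A k) ^+ 2) <=
    sample_mean (fun k => d B (A k) ^+ 2).

Definition frechet_median (R : rcfType) (n N : nat) (d : 'M[R]_n -> 'M[R]_n -> R)
    (A : 'I_N -> 'M[R]_n) (M : 'M[R]_n) : Prop :=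
  adjacency M /\
  forall B : 'M[R]_n, adjacency B ->
    sample_mean (fun k => d M (A k)) <= sample_mean (fun k => d B (A k)).

Definition edge_frequency (R : rcfType) (n N : nat) (A : 'I_N -> 'M[R]_n)
    (i j : 'I_n) : R :=
  sample_mean (fun k => A k i j).

(* Main.v *)
Require Import Defs.
From mathcomp Require Import all_boot all_order all_algebra.
From mathcomp Require Import ring lra.
From mathcomp Require Import sesquilinear spectral complex.

Import Order.TTheory GRing.Theory Num.Theory.
Local Open Scope ring_scope.

Set Implicit Arguments.
Unset Strict Implicit.
Unset Printing Implicit Defensive.

(** Both distances come with a size [w], namely [w A = e(A)] for the Hamming
    distance and [w A = ||lambda(A)||_2 = sqrt (2 e(A))] for the spectral one,
    such that [|w A - w B| <= d A B] and [d 0 A = w A].  Comparing a Fréchet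
    mean or median [M] with the empty graph then gives [w M <= 2 mean (w A_k)].
    In the Hamming case this reads [e(M) <= 2 ebar]; in the spectral case,
    squaring and using Jensen's inequality, it gives [e(M) <= 4 ebar].  The
    strict bound for the Hamming median comes from comparing [M] with the graph
    obtained by deleting a single edge of [M]: every edge of [M] has frequency
    at least 1/2. *)

Lemma ltr_sum_some (R : numDomainType) (I : finType) (P : pred I) (F G : I -> R)
    (i0 : I) :
  P i0 -> (forall i, P i -> F i <= G i) -> F i0 < G i0 ->
  \sum_(i | P i) F i < \sum_(i | P i) G i.
Proof.
move=> Pi0 leFG ltFG; rewrite (bigD1 i0) //= [X in _ < X](bigD1 i0) //=.
by apply: ltr_leD => //; apply: ler_sum => i /andP[/leFG].
Qed.

Lemma sqr_le_norm (R : realDomainType) (x y : R) : `|x| <= y -> x ^+ 2 <= y ^+ 2.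
Proof.
move=> xy; rewrite -real_normK ?num_real // ler_sqr ?nnegrE //.
exact: le_trans xy.
Qed.

(** * Sample means *)

Section SampleMean.

Variables (R : rcfType) (N : nat).
Implicit Types (x y d : 'I_N -> R) (a c : R).

Lemma sample_meanD x y :
  sample_mean (fun k => x k + y k) = sample_mean x + sample_mean y.
Proof. by rewrite /sample_mean big_split mulrDr. Qed.

Lemma sample_meanZ c x : sample_mean (fun k => c * x k) = c * sample_mean x.
Proof. by rewrite /sample_mean -mulr_sumr mulrCA. Qed.

Lemma eq_sample_mean x y : x =1 y -> sample_mean x = sample_mean y.
Proof. by move=> xy; congr (_ * _); apply: eq_bigr. Qed.

Lemma sample_mean_sum (I : finType) (P : pred I) (F : I -> 'I_N -> R) :
  sample_mean (fun k => \sum_(i | P i) F i k)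
  = \sum_(i | P i) sample_mean (F i).
Proof. by rewrite /sample_mean exchange_big mulr_sumr. Qed.

Lemma le_sample_mean x y :
  (forall k, x k <= y k) -> sample_mean x <= sample_mean y.
Proof.
move=> xy; rewrite ler_wpM2l ?invr_ge0 ?ler0n //.
by apply: ler_sum => k _; apply: xy.
Qed.

Lemma sample_mean_ge0 x : (forall k, 0 <= x k) -> 0 <= sample_mean x.
Proof. by move=> x0; rewrite mulr_ge0 ?invr_ge0 ?ler0n ?sumr_ge0. Qed.

Hypothesis N_gt0 : (0 < N)%N.

Lemma sample_mean_cst c : sample_mean (fun _ : 'I_N => c) = c.
Proof.
rewrite /sample_mean sumr_const card_ord -[c *+ N]mulr_natl mulKf //.
by rewrite pnatr_eq0 -lt0n.
Qed.

Lemma lt_sample_mean x y k :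
  (forall k, x k <= y k) -> x k < y k -> sample_mean x < sample_mean y.
Proof.
move=> xy xyk; rewrite ltr_pM2l ?invr_gt0 ?ltr0n //.
by apply: (@ltr_sum_some _ _ _ _ _ k) => // i _; apply: xy.
Qed.

Lemma sample_mean_sqrB a x :
  sample_mean (fun k => (a - x k) ^+ 2)
  = a ^+ 2 - 2 * a * sample_mean x + sample_mean (fun k => x k ^+ 2).
Proof.
pose y k := a ^+ 2 + - (2 * a) * x k + x k ^+ 2.
rewrite (@eq_sample_mean _ y) => [|k]; last by rewrite /y; ring.
by rewrite /y !sample_meanD (sample_meanZ (- (2 * a))) sample_mean_cst mulNr.
Qed.

Lemma sample_varianceE x :
  sample_variance x = sample_mean (fun k => (sample_mean x - x k) ^+ 2).
Proof. by rewrite sample_mean_sqrB /sample_variance; ring. Qed.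

Lemma sample_variance_ge0 x : 0 <= sample_variance x.
Proof. by rewrite sample_varianceE sample_mean_ge0 // => k; rewrite sqr_ge0. Qed.

(** The variance is a mean of squared deviations, so a single value off the mean would make it
    positive. *)
Lemma sample_stddev_le0 x k : sample_stddev x <= 0 -> x k = sample_mean x.
Proof.
rewrite leNgt sqrtr_gt0 => /negP nlt; apply/eqP/negPn/negP => xk; case: nlt.
rewrite sample_varianceE -(sample_mean_cst 0).
apply: (@lt_sample_mean _ _ k) => [j|]; first exact: sqr_ge0.
by rewrite lt_def sqr_ge0 sqrf_eq0 subr_eq0 eq_sym xk.
Qed.

(** Here [a] is the size of a minimizer, [x k] that of the [k]-th graph and [d k] their distance;
    the last hypothesis is minimality against the empty graph. Replacing [d k] by [a - x k] and
    expanding, the mean of [x k ^+ 2] cancels and [a ^+ 2 <= 2 * a * sample_mean x] remains. *)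
Lemma frechet_mean_size_le a x d :
  0 <= a -> (forall k, 0 <= x k) -> (forall k, `|a - x k| <= d k) ->
  sample_mean (fun k => d k ^+ 2) <= sample_mean (fun k => x k ^+ 2) ->
  a <= 2 * sample_mean x.
Proof.
move=> a0 x0 ad dx.
(* The case [a = 0] is set apart because the end of the proof divides by [a]. *)
have [->|an0] := eqVneq a 0; first by rewrite mulr_ge0 ?ler0n ?sample_mean_ge0.
have ap : 0 < a by rewrite lt_def an0.
have : sample_mean (fun k => (a - x k) ^+ 2) <= sample_mean (fun k => x k ^+ 2).
  apply: le_trans dx; apply: le_sample_mean => k.
  exact: sqr_le_norm.
rewrite sample_mean_sqrB gerDr => h.
by rewrite -(ler_pM2l ap) -subr_le0 mulrA [a * 2]mulrC -expr2.
Qed.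

Lemma frechet_median_size_le a x d :
  (forall k, `|a - x k| <= d k) -> sample_mean d <= sample_mean x ->
  a <= 2 * sample_mean x.
Proof.
move=> ad dx.
have : a - sample_mean x <= sample_mean d.
  rewrite -[X in X - _]sample_mean_cst -mulN1r -sample_meanZ -sample_meanD.
  apply: le_sample_mean => k; rewrite mulN1r.
  exact: le_trans (ler_norm _) (ad k).
move=> h; lra.
Qed.

End SampleMean.

(** * Edges and the Hamming distance *)

Section Hamming.

Variables (R : rcfType) (n : nat).
Implicit Types A B M : 'M[R]_n.

Lemma edgesE A : edges A = \sum_(p : 'I_n * 'I_n | (p.1 < p.2)%N) A p.1 p.2.
Proof. by rewrite /edges pair_big_dep. Qed.

Lemma hammingE A B :
  hamming A B = \sum_(p : 'I_n * 'I_n | (p.1 < p.2)%N) `|A p.1 p.2 - B p.1 p.2|.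
Proof. by rewrite /hamming pair_big_dep. Qed.

Lemma adjacency0 : adjacency (0 : 'M[R]_n).
Proof. by split=> *; rewrite !mxE //; left. Qed.

Lemma adjacency_ge0 A i j : adjacency A -> 0 <= A i j.
Proof. by case=> /(_ i j)[] -> _ _ //; rewrite ler01. Qed.

Lemma edges_ge0 A : adjacency A -> 0 <= edges A.
Proof. by move=> hA; rewrite edgesE sumr_ge0 // => p _; apply: adjacency_ge0. Qed.

Lemma hamming0l A : adjacency A -> hamming 0 A = edges A.
Proof.
move=> hA; rewrite hammingE edgesE; apply: eq_bigr => p _.
by rewrite mxE sub0r normrN ger0_norm // adjacency_ge0.
Qed.

Lemma edgesB_le_hamming A B : `|edges A - edges B| <= hamming A B.
Proof. by rewrite !edgesE -sumrB hammingE ler_norm_sum. Qed.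

(** A pair with [A i j < B i j] contributes a negative term to the difference of edge counts and a
    nonnegative one to the distance. *)
Lemma edgesB_lt_hamming A B i j :
  adjacency A -> adjacency B -> A i j < B i j -> edges A - edges B < hamming A B.
Proof.
move=> [_ As A0] [_ Bs B0].
(* Both sums only see pairs above the diagonal: symmetry brings [(i, j)] there, and on the diagonal
   both entries are 0. *)
wlog lt_ij : i j / (i < j)%N => [th|] ltAB.
  have [lt|gt|/val_inj eq_ij] := ltngtP i j; first exact: th ltAB.
    by apply: (th j i) => //; rewrite As Bs.
  by move: ltAB; rewrite eq_ij A0 B0 ltxx.
rewrite !edgesE -sumrB hammingE.
apply: (@ltr_sum_some _ _ _ _ _ (i, j)) => //= [p _|]; first exact: ler_norm.
by apply: (@lt_le_trans _ _ 0); rewrite ?normr_ge0 // subr_lt0.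
Qed.

(** Both orientations are cleared so that symmetry is preserved. *)
Definition remove_edge M (i j : 'I_n) : 'M[R]_n :=
  \matrix_(k, l) if ((k, l) == (i, j)) || ((k, l) == (j, i)) then 0 else M k l.

Lemma adjacency_remove_edge M i j :
  adjacency M -> adjacency (remove_edge M i j).
Proof.
move=> [M01 Ms M0]; split=> [k l|k l|k]; rewrite !mxE; last by case: ifP.
  by case: ifP => _; [left | apply: M01].
by rewrite Ms !xpair_eqE orbC [(k == j) && _]andbC [(k == i) && _]andbC.
Qed.

Lemma hamming_remove_edge M A (i j : 'I_n) :
  adjacency M -> adjacency A -> (i < j)%N ->
  hamming M A - hamming (remove_edge M i j) A = M i j * (1 - 2 * A i j).
Proof.
move=> [M01 _ _] [A01 _ _] lt_ij; rewrite !hammingE.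
rewrite (bigD1 (i, j)) //= [X in _ - X](bigD1 (i, j)) //= !mxE eqxx /=.
have -> : \sum_(p : 'I_n * 'I_n | (p.1 < p.2)%N && (p != (i, j)))
    `|remove_edge M i j p.1 p.2 - A p.1 p.2|
  = \sum_(p : 'I_n * 'I_n | (p.1 < p.2)%N && (p != (i, j)))
    `|M p.1 p.2 - A p.1 p.2|.
  (* The other cleared entry [(j, i)] lies below the diagonal, outside the range of the sum. *)
  apply: eq_bigr => -[k l] /andP[/= ltkl nij]; rewrite mxE (negPf nij) /=.
  case: eqP => // -[ek el]; move: ltkl.
  by rewrite ek el ltnNge ltnW.
rewrite opprD addrACA subrr addr0 sub0r normrN.
case: (M01 i j) => ->; case: (A01 i j) => ->;
  rewrite ?subrr ?subr0 ?sub0r ?normrN ?normr0 ?normr1; ring.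
Qed.

Variables (N : nat) (A : 'I_N -> 'M[R]_n).
Hypotheses (N_gt0 : (0 < N)%N) (A_adj : forall k, adjacency (A k)).

Lemma edge_frequency_ge0 i j : 0 <= edge_frequency A i j.
Proof. by apply: sample_mean_ge0 => k; apply: adjacency_ge0. Qed.

Lemma sample_mean_edges :
  sample_mean (fun k => edges (A k))
  = \sum_(p : 'I_n * 'I_n | (p.1 < p.2)%N) edge_frequency A p.1 p.2.
Proof.
by rewrite -sample_mean_sum; apply: eq_sample_mean => k; rewrite edgesE.
Qed.

Lemma hamming_mean_le M :
  frechet_mean (@hamming R n) A M ->
  edges M <= 2 * sample_mean (fun k => edges (A k)).
Proof.
move=> [M_adj /(_ _ adjacency0) le_M].
apply: (@frechet_mean_size_le R N N_gt0 _ _ (fun k => hamming M (A k))) => //.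
- exact: edges_ge0.
- by move=> k; apply: edges_ge0.
- by move=> k; apply: edgesB_le_hamming.
by move: le_M; under [X in _ <= X]eq_sample_mean => k do rewrite hamming0l //.
Qed.

(** This is the equality case of [hamming_mean_le]: the parabola [a ^+ 2 - 2 * a * ebar] vanishes at
    [a = 2 * ebar] as it does at 0, so the empty graph does at least as well as [M]. *)
Lemma hamming_mean_zero M :
  frechet_mean (@hamming R n) A M ->
  edges M = 2 * sample_mean (fun k => edges (A k)) ->
  frechet_mean (@hamming R n) A 0.
Proof.
move=> [M_adj le_M] eM; split=> [|B /le_M]; first exact: adjacency0.
apply: le_trans; under eq_sample_mean => k do rewrite hamming0l //.
apply: (@le_trans _ _ (sample_mean (fun k => (edges M - edges (A k)) ^+ 2))).
  by rewrite sample_mean_sqrB // eM lerDr; lra.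
apply: le_sample_mean => k.
exact/sqr_le_norm/edgesB_le_hamming.
Qed.

(** With zero deviation every [edges (A l)] is the mean. If [edges M] were twice that, each [A l]
    would be at least as far from [M] as from the empty graph, and [A k] strictly farther because
    [M] misses one of its edges; the empty graph would then beat [M]. *)
Lemma hamming_mean_lt M k (i j : 'I_n) :
  frechet_mean (@hamming R n) A M ->
  sample_stddev (fun k => edges (A k)) <= 0 -> M i j < A k i j ->
  edges M < 2 * sample_mean (fun k => edges (A k)).
Proof.
move=> Mmean s0 ltMA; rewrite lt_neqAle hamming_mean_le // andbT.
apply/eqP => eM; case: Mmean => M_adj /(_ _ adjacency0).
under [X in _ <= X]eq_sample_mean => l do rewrite hamming0l //.
apply/negP; rewrite -ltNge.
have eE l := sample_stddev_le0 N_gt0 l s0.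
have le_d l : edges (A l) <= hamming M (A l).
  have := le_trans (ler_norm _) (edgesB_le_hamming M (A l)).
  by rewrite eM -(eE l) => h; lra.
apply: (@lt_sample_mean _ _ N_gt0 _ _ k) => [l|].
  by rewrite sqr_le_norm // ger0_norm ?edges_ge0.
have := edgesB_lt_hamming M_adj (A_adj k) ltMA.
rewrite eM -(eE k) => h.
have {}h : edges (A k) < hamming M (A k) by lra.
by rewrite ltrXn2r ?edges_ge0.
Qed.

(** The left side is the excess of the cost of [M] over that of [remove_edge M i j], obtained by
    averaging [hamming_remove_edge] over the sample. *)
Lemma hamming_median_edge M (i j : 'I_n) :
  frechet_median (@hamming R n) A M -> (i < j)%N ->
  M i j * (1 - 2 * edge_frequency A i j) <= 0.
Proof.
move=> [M_adj le_M] lt_ij.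
have := le_M _ (adjacency_remove_edge i j M_adj).
rewrite -subr_le0 -mulN1r -sample_meanZ -sample_meanD.
rewrite (@eq_sample_mean _ _ _ (fun k => M i j + - (2 * M i j) * A k i j)); last first.
  by move=> k; rewrite mulN1r hamming_remove_edge //; ring.
rewrite sample_meanD (sample_meanZ (- (2 * M i j))) sample_mean_cst //.
by rewrite mulrBr mulr1 [M i j * (2 * _)]mulrCA mulrA mulNr.
Qed.

Lemma hamming_median_le_frequency M (i j : 'I_n) :
  frechet_median (@hamming R n) A M -> (i < j)%N ->
  M i j <= 2 * edge_frequency A i j.
Proof.
move=> Mmed lt_ij; have := hamming_median_edge Mmed lt_ij.
have f0 := edge_frequency_ge0 i j.
by case: Mmed => -[/(_ i j)[] -> _ _ _] h; lra.
Qed.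

Lemma hamming_median_le M :
  frechet_median (@hamming R n) A M ->
  edges M <= 2 * sample_mean (fun k => edges (A k)).
Proof.
move=> Mmed; rewrite sample_mean_edges edgesE mulr_sumr.
by apply: ler_sum => p; apply: hamming_median_le_frequency.
Qed.

Lemma hamming_median_lt M (i j : 'I_n) :
  frechet_median (@hamming R n) A M -> (i < j)%N ->
  edge_frequency A i j <> 0 -> edge_frequency A i j <> 1 / 2 ->
  edges M < 2 * sample_mean (fun k => edges (A k)).
Proof.
move=> Mmed lt_ij f0 fh; rewrite sample_mean_edges edgesE mulr_sumr.
apply: (@ltr_sum_some _ _ _ _ _ (i, j)) => //= [p|].
  exact: hamming_median_le_frequency.
(* Equality at [(i, j)] would give [M i j = 2 * edge_frequency A i j] with [M i j] equal to 0 or 1: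
   these are the two excluded frequencies. *)
rewrite lt_neqAle hamming_median_le_frequency // andbT; apply/eqP => e.
by case: Mmed => -[/(_ i j)[] h _ _ _]; move: e; rewrite h => e;
  [apply: f0 | apply: fh]; lra.
Qed.

End Hamming.

(** * Spectra *)

Section Spectral.

Variables (R : rcfType) (n : nat).
Implicit Types (A B M : 'M[R]_n) (u v : 'rV[R]_n).

Lemma mxtrace_sqr_uconj (F : fieldType) (P : 'M[F]_n) (d : 'rV[F]_n) :
  P \in unitmx ->
  let B := invmx P *m diag_mx d *m P in \tr (B *m B) = \sum_i d 0 i ^+ 2.
Proof.
move=> Pu /=; rewrite !mulmxA mulmxK // mxtrace_mulC !mulmxA mulmxV // mul1mx.
by rewrite mulmx_diag mxtrace_diag; apply: eq_bigr => i _; rewrite mxE.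
Qed.

(* Diagonalising over the complex numbers gives the sum of squares as a trace;
   unique factorisation of the characteristic polynomial identifies the diagonal
   with the spectrum. *)
Lemma sum_spectrum_sqr A :
  A^T = A -> \sum_(x <- spectrum A) x ^+ 2 = \tr (A *m A).
Proof.
move=> As; have [_ _ sE] := spectrumP As.
pose B := map_mx (real_complex R) A.
have BR : B \is a realmx by apply/mxOverP => i j; rewrite mxE complex_real.
have BS : B \is symmetricmx.
  by apply/is_hermitianmxP; rewrite expr0 scale1r map_mx_id // map_trmx As.
have BH := realsym_hermsym BS BR.
have /orthomx_spectralP BE := hermitian_normalmx BH.
have Pu : spectralmx B \in unitmx by apply: spectral_unit.
apply: (fmorph_inj (real_complex R)); rewrite -trace_map_mx map_mxM -/B.
rewrite [in RHS]BE mxtrace_sqr_uconj // rmorph_sum /=.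
under eq_bigr => x _ do rewrite rmorphXn /=.
rewrite -(big_map (real_complex R) xpredT (fun z => z ^+ 2)).
have pE : perm_eq (map (real_complex R) (spectrum A))
                  [seq spectral_diag B 0 i | i <- index_enum 'I_n].
  apply: prod_XsubC_eq; rewrite !big_map.
  transitivity (char_poly B).
    rewrite -map_char_poly sE rmorph_prod; apply: eq_bigr => x _.
    by rewrite /= rmorphB /= map_polyX map_polyC.
  rewrite {1}BE char_poly_uconj // char_poly_trig ?diag_mx_is_trig //.
  by apply: eq_bigr => i _; rewrite !mxE eqxx mulr1n.
by rewrite (perm_big _ pE) big_map.
Qed.

(** Entries are idempotent, so the diagonal of [A *m A] carries the degrees, and degrees count each
    edge twice. *)
Lemma mxtrace_sqr_adjacency A : adjacency A -> \tr (A *m A) = 2 * edges A.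
Proof.
move=> [A01 As A0]; rewrite edgesE /mxtrace.
under eq_bigr => i _.
  rewrite mxE; under eq_bigr => j _.
    have -> : A i j * A j i = A i j.
      by rewrite [A j i]As; case: (A01 i j) => ->; rewrite ?mulr0 ?mulr1.
    over.
  over.
rewrite pair_big /= (bigID (fun p : 'I_n * 'I_n => (p.1 < p.2)%N)) /=.
rewrite mulr_natl mulr2n; congr (_ + _).
(* Swapping sends the remaining pairs to those with [i <= j], whose diagonal terms vanish. *)
rewrite (reindex_inj (can_inj swap_pairK)) /= big_mkcond [RHS]big_mkcond.
apply: eq_bigr => -[i j] _ /=; rewrite -leqNgt As leq_eqVlt.
by case: eqP => [/val_inj ->|] //=; rewrite A0 ltnn.
Qed.

Lemma norm2_ge0 v : 0 <= norm2 v.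
Proof. exact: sqrtr_ge0. Qed.

Lemma sqr_norm2 v : norm2 v ^+ 2 = \sum_i v 0 i ^+ 2.
Proof. by rewrite sqr_sqrtr // sumr_ge0 // => i _; rewrite sqr_ge0. Qed.

Lemma norm2_eq0 v : norm2 v = 0 -> v = 0.
Proof.
move=> v0; have /eqP := sqr_norm2 v; rewrite v0 expr0n eq_sym psumr_eq0.
  move=> /allP v20; apply/rowP => i; rewrite mxE; apply/eqP.
  by rewrite -sqrf_eq0; apply: v20; rewrite mem_index_enum.
by move=> i _; rewrite sqr_ge0.
Qed.

(** Cauchy-Schwarz, from expanding the sum of squares of [b * u - a * v] with [a] and [b] the norms;
    zero norms are treated first so that [2 * (a * b)] can be divided out. *)
Lemma dot_le_norm2 u v : \sum_i u 0 i * v 0 i <= norm2 u * norm2 v.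
Proof.
have [/norm2_eq0 ->|u0] := eqVneq (norm2 u) 0.
  rewrite big1 => [|i _]; last by rewrite mxE mul0r.
  by rewrite mulr_ge0 ?norm2_ge0.
have [/norm2_eq0 ->|v0] := eqVneq (norm2 v) 0.
  rewrite big1 => [|i _]; last by rewrite mxE mulr0.
  by rewrite mulr_ge0 ?norm2_ge0.
have up : 0 < norm2 u by rewrite lt_def u0 norm2_ge0.
have vp : 0 < norm2 v by rewrite lt_def v0 norm2_ge0.
set a := norm2 u; set b := norm2 v; set S := \sum_i _.
have : 0 <= \sum_i (b * u 0 i - a * v 0 i) ^+ 2.
  by apply: sumr_ge0 => i _; rewrite sqr_ge0.
have -> : \sum_i (b * u 0 i - a * v 0 i) ^+ 2 = (2 * (a * b)) * (a * b - S).
  transitivity (b ^+ 2 * a ^+ 2 - (2 * (a * b)) * S + a ^+ 2 * b ^+ 2); last by ring.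
  rewrite [X in _ * X - _]sqr_norm2 [X in _ + _ * X]sqr_norm2 !mulr_sumr.
  by rewrite -sumrB -big_split; apply: eq_bigr => i _ /=; ring.
by rewrite pmulr_rge0 ?subr_ge0 // !mulr_gt0 ?ltr0n.
Qed.

(** Once squared, this is [dot_le_norm2]. *)
Lemma norm2B_le u v : `|norm2 u - norm2 v| <= norm2 (u - v).
Proof.
rewrite -ler_sqr ?nnegrE ?norm2_ge0 // real_normK ?num_real // sqr_norm2.
have -> : \sum_i (u - v) 0 i ^+ 2
    = norm2 u ^+ 2 - 2 * (\sum_i u 0 i * v 0 i) + norm2 v ^+ 2.
  rewrite !sqr_norm2 mulr_sumr -sumrB -big_split.
  by apply: eq_bigr => i _; rewrite !mxE /=; ring.
have := dot_le_norm2 u v; nra.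
Qed.

Definition spectral_size A : R := norm2 (eigenvalues A).

Lemma sqr_spectral_size A : adjacency A -> spectral_size A ^+ 2 = 2 * edges A.
Proof.
move=> hA; rewrite -mxtrace_sqr_adjacency //.
have As : A^T = A by apply/matrixP => i j; rewrite mxE; case: hA.
rewrite -sum_spectrum_sqr // sqr_norm2 (big_nth 0) big_mkord.
(* The list [spectrum A] has exactly [n] entries, so [eigenvalues] never reads the default value. *)
have [-> _ _] := spectrumP As.
by apply: eq_bigr => i _; rewrite mxE.
Qed.

Lemma spectral_dist0l A : spectral_dist 0 A = spectral_size A.
Proof.
(* The eigenvalues of the empty graph vanish because their squares sum to twice its number of
   edges. *)
have : spectral_size 0 ^+ 2 = 0.
  rewrite sqr_spectral_size; last exact: adjacency0.
  by rewrite edgesE big1 ?mulr0 // => p _; rewrite mxE.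
move=> /eqP; rewrite sqrf_eq0 => /eqP/norm2_eq0 e0.
rewrite /spectral_dist e0 sub0r; congr Num.sqrt.
by apply: eq_bigr => i _; rewrite mxE sqrrN.
Qed.

Variables (N : nat) (A : 'I_N -> 'M[R]_n).
Hypotheses (N_gt0 : (0 < N)%N) (A_adj : forall k, adjacency (A k)).

(** With [m] the mean size, [edges M <= 2 * m ^+ 2], and nonnegativity of the variance bounds
    [m ^+ 2] by the mean squared size, which is twice the mean number of edges. *)
Lemma edges_le_of_spectral_size M : adjacency M ->
  spectral_size M <= 2 * sample_mean (fun k => spectral_size (A k)) ->
  edges M <= 4 * sample_mean (fun k => edges (A k)).
Proof.
move=> M_adj le_M; set m := sample_mean (fun k => spectral_size _) in le_M.
have := sample_variance_ge0 N_gt0 (fun k => spectral_size (A k)).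
rewrite /sample_variance -/m subr_ge0.
rewrite (@eq_sample_mean _ _ _ (fun k => 2 * edges (A k))); last first.
  by move=> k; rewrite sqr_spectral_size.
rewrite sample_meanZ => jensen.
have : spectral_size M ^+ 2 <= (2 * m) ^+ 2.
  by apply: sqr_le_norm; rewrite ger0_norm // norm2_ge0.
rewrite sqr_spectral_size // => h; nra.
Qed.

Lemma spectral_mean_le M :
  frechet_mean (@spectral_dist R n) A M ->
  edges M <= 4 * sample_mean (fun k => edges (A k)).
Proof.
move=> [M_adj /(_ _ (adjacency0 _ _)) le_M]; apply: edges_le_of_spectral_size => //.
apply: (@frechet_mean_size_le R N N_gt0 _ _ (fun k => spectral_dist M (A k))).
- exact: norm2_ge0.
- by move=> k; apply: norm2_ge0.
- by move=> k; apply: norm2B_le.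
by move: le_M; under [X in _ <= X]eq_sample_mean => k do rewrite spectral_dist0l.
Qed.

Lemma spectral_median_le M :
  frechet_median (@spectral_dist R n) A M ->
  edges M <= 4 * sample_mean (fun k => edges (A k)).
Proof.
move=> [M_adj /(_ _ (adjacency0 _ _)) le_M]; apply: edges_le_of_spectral_size => //.
apply: (@frechet_median_size_le R N N_gt0 _ _ (fun k => spectral_dist M (A k))).
  by move=> k; apply: norm2B_le.
by move: le_M; under [X in _ <= X]eq_sample_mean => k do rewrite spectral_dist0l.
Qed.

End Spectral.

(** For a sample of empty graphs both sides of all four inequalities are 0, so the bounds are stated
    as non-strict, with conditions that make them strict. The Hamming median also attains its bound
    for a sample made of one single-edge graph and one empty graph. *)
Theorem theorem1 (R : rcfType) (n N : nat) (A : 'I_N -> 'M[R]_n)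
    (N_gt0 : (0 < N)%N) (A_adj : forall k : 'I_N, adjacency (A k)) :
  let ebar := sample_mean (fun k => edges (A k)) in
  let sigma := sample_stddev (fun k => edges (A k)) in
  ((forall M : 'M[R]_n, frechet_mean (@hamming R n) A M ->
      edges M <= 2 * ebar + sigma / Num.sqrt 2 /\
      ([\/ 0 < sigma, ~ frechet_mean (@hamming R n) A 0
         | exists (k : 'I_N) (i j : 'I_n), M i j < A k i j] ->
       edges M < 2 * ebar + sigma / Num.sqrt 2)) /\
   (forall M : 'M[R]_n, frechet_median (@hamming R n) A M ->
      edges M <= 2 * ebar /\
      ((exists i j : 'I_n, [/\ (i < j)%N, edge_frequency A i j <> 0
                             & edge_frequency A i j <> 1 / 2]) ->
       edges M < 2 * ebar))) /\
  ((forall M : 'M[R]_n, frechet_mean (@spectral_dist R n) A M ->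
      edges M <= 9 * ebar /\ (0 < ebar -> edges M < 9 * ebar)) /\
   (forall M : 'M[R]_n, frechet_median (@spectral_dist R n) A M ->
      edges M <= 9 * ebar /\ (0 < ebar -> edges M < 9 * ebar))).
Proof.
move=> ebar sigma.
have ebar0 : 0 <= ebar by apply: sample_mean_ge0 => k; apply: edges_ge0.
have s0 : 0 <= sigma / Num.sqrt 2 by rewrite divr_ge0 ?sqrtr_ge0.
split; split=> M hM.
- have le_M := hamming_mean_le N_gt0 A_adj hM; rewrite -/ebar in le_M.
  split; first by rewrite (le_trans le_M) // lerDl.
  (* Since [2 * ebar] is already a bound, a positive [sigma] gives strictness at once. *)
  have [sp _|sle0] := ltP 0 sigma.
    by rewrite (le_lt_trans le_M) // ltrDl divr_gt0 // sqrtr_gt0 ltr0n.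
  move=> cond; suff lt_M : edges M < 2 * ebar.
    by rewrite (lt_le_trans lt_M) // lerDl.
  case: cond => [|not0|[k [i [j]]]] //.
    rewrite lt_neqAle le_M andbT; apply/eqP => eM.
    exact/not0/(hamming_mean_zero N_gt0 A_adj hM).
  exact: hamming_mean_lt.
- split; first exact: hamming_median_le.
  by move=> [i [j [lt_ij f0 fh]]]; apply: hamming_median_lt lt_ij f0 fh.
- have := spectral_mean_le N_gt0 A_adj hM; rewrite -/ebar => h.
  by split=> *; lra.
- have := spectral_median_le N_gt0 A_adj hM; rewrite -/ebar => h.
  by split=> *; lra.
Qed.
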